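(* Let $p>2$ be a prime and let $\Psi$ be a $2\times k$ system over $\mathbb{F}_p$ such that $s(\Psi)=k-1$ and which does not contain an additive $k$-tuple. Then there exists $f:\mathbb{F}_p^2 \to [-1,1]$ with $\mathbb{E}_{x\in\mathbb{F}_p^2} f(x) = 0$ and such that $T_\Psi(f) < 0$.
   Context: A $2\times k$ system $\Psi$ is a system of $2$ homogeneous linear equations in $k$ variables, given by a $2\times k$ matrix $M_\Psi$ over $\mathbb{F}_p$ of full rank $2$, with $k>2$. For $n\ge1$, $\mathrm{sol}(\Psi;\mathbb{F}_p^n)$ is the set of $x=(x_1,\dots,x_k)\in(\mathbb{F}_p^n)^k$ with $M_\Psi x=0$. For $f:\mathbb{F}_p^n\to\mathbb{C}$, $T_\Psi(f)=\mathbb{E}_{x\in \mathrm{sol}(\Psi;\mathbb{F}_p^n)} f(x_1)\cdots f(x_k)$ (normalised average). The length of an equation is its number of nonzero coefficients; $s(\Psi)$ is the minimum length of a nonzero equation in the row space of $M_\Psi$. An additive $k$-tuple is (for $k$ even) the equation $x_1+\dots+x_{k/2}=x_{k/2+1}+\dots+x_k$; $\Psi$ contains an additive $k$-tuple if some nonzero vector in the row space of $M_\Psi$ is a nonzero scalar multiple of a vector having $k/2$ entries equal to $1$ and $k/2$ entries equal to $-1$ (for $k$ odd this never happens). *)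

(* Defs.v *)
From mathcomp Require Import all_boot all_order all_algebra.
From mathcomp Require Import reals.

Set Implicit Arguments.
Unset Strict Implicit.
Unset Printing Implicit Defensive.

Import Order.TTheory GRing.Theory Num.Theory.
Local Open Scope ring_scope.

(* The normalised average of [f] over [A]. *)
Definition average (K : numFieldType) (T : finType) (A : {set T}) (f : T -> K)
    : K :=
  (\sum_(x in A) f x) / #|A|%:R.

Section Systems.

Variables (F : finFieldType) (k : nat).

(* An equation in k variables is identified with its row of coefficients. *)
Definition eq_length (v : 'rV[F]_k) : nat := #|[set j | v 0 j != 0]|.

(* [k] bounds every length, so it is a harmless default for the minimum as soon
   as the row space of [M] is nonzero. *)
Definition min_length (M : 'M[F]_(2, k)) : nat :=
  \big[minn/k]_(v : 'rV[F]_k | (v <= M)%MS && (v != 0)) eq_length v.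

(* Over a field of characteristic other than 2 the two sets are disjoint, so
   these conditions force every entry to be 1 or -1; they fail for odd [k]. *)
Definition balanced_signs (w : 'rV[F]_k) : Prop :=
  (2 * #|[set j | w 0%R j == 1%R]| = k)%N /\
  (2 * #|[set j | w 0%R j == (-1)%R]| = k)%N.

Definition contains_additive_tuple (M : 'M[F]_(2, k)) : Prop :=
  exists v : 'rV[F]_k, [/\ (v <= M)%MS, v != 0 &
    exists (c : F) (w : 'rV[F]_k),
      [/\ c != 0, balanced_signs w & v = c *: w]].

(* A k-tuple of points of F^n is a k x n matrix whose i-th row is x_i. *)
Definition sol (n : nat) (M : 'M[F]_(2, k)) : {set 'M[F]_(k, n)} :=
  [set x | M *m x == 0].

Definition T_system (K : numFieldType) (n : nat) (M : 'M[F]_(2, k))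
    (f : 'rV[F]_n -> K) : K :=
  average (sol n M) (fun x => \prod_(i < k) f (row i x)).

End Systems.

(* Main.v *)
(* For phases t in F_p^k let f_t(x) be the average over m of
   cos (2 pi (v_m . x + t_m) / p), where v_1, ..., v_k are the columns of M:
   its Fourier transform lives on the k pairwise distinct directions v_m.
   Expanding T(f_t) in characters of (x, t), a term survives the summation over
   x only if it comes from a 2 x 2 matrix G with G v_i = +- v_(j i) for all i.
   If G is invertible then j is a permutation, and the term is a nontrivial
   character of t.  Otherwise j is constant, the signs form an equation of the
   system, and the term is again nontrivial in t unless these signs sum to 0 in
   F_p, which for k even would be an additive k-tuple because k <= p.
   So T(f_t) sums to 0 over t, whereas T(f_0) > 0 as all of its terms are
   nonnegative and the one from G = 1 is positive; hence T(f_t) < 0 for some t.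
   For k odd, - f_0 works. *)
Require Import Defs.
From mathcomp Require Import all_boot all_order all_algebra.
From mathcomp Require Import reals complex.

Import Order.TTheory GRing.Theory Num.Theory.
Local Open Scope ring_scope.

(** * Sign equations and pairwise independent columns *)

(** Any two columns are linearly independent; the dual form fits its use on equations [w *m M]. *)
Definition columns_independent {F : fieldType} {k : nat} (M : 'M[F]_(2, k)) :=
  forall (w : 'rV_2) (i j : 'I_k),
    i != j -> (w *m M) 0 i = 0 -> (w *m M) 0 j = 0 -> w = 0.

(** A nonzero equation with two zero coefficients would have length at most k - 2; full rank makes
    [w *m M] nonzero as soon as [w] is. *)
Lemma columns_independent_min_length (F : finFieldType) (k : nat)
    (M : 'M[F]_(2, k)) :
  \rank M = 2%N -> min_length M = (k - 1)%N -> (1 < k)%N ->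
  columns_independent M.
Proof.
move=> rM minM k1 w i j ij wi wj; apply/eqP/negPn/negP => w0.
have wM0 : w *m M != 0.
  by rewrite mulmx_free_eq0 // /row_free rM.
have len : (k - 1 <= eq_length (w *m M))%N.
  rewrite -minM; apply: (bigmin_le_cond (T := nat)).
  by rewrite submxMl.
have: (eq_length (w *m M) + 2 <= k)%N.
  have c2 : #|[set i; j]| = 2%N by rewrite cards2 ij.
  rewrite -[leqRHS]card_ord -(cardsC [set i; j]) c2 addnC leq_add2l.
  apply/subset_leq_card/subsetP => m; rewrite !inE.
  by apply: contraNN => /orP[] /eqP ->; apply/eqP.
move=> /(leq_trans (leq_add len (leqnn 2))).
by rewrite addn2 subn1 prednK ?ltnn // ltnW.
Qed.

Lemma exists_annihilator (F : fieldType) (k : nat) (M : 'M[F]_(2, k)) i :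
  exists2 w : 'rV_2, w != 0 & (w *m M) 0 i = 0.
Proof.
have: kermx (col i M) != 0.
  rewrite kermx_eq0 -row_leq_rank -ltnNge.
  by apply: leq_ltn_trans (rank_leq_col _) _.
move=> /rowV0Pn[w /sub_kermxP wi w0]; exists w => //.
by move/matrixP/(_ 0 0): wi; rewrite colE mulmxA -colE mxE [RHS]mxE.
Qed.

Definition signs {F : pzRingType} {k : nat} (b : 'I_k -> bool) : 'rV[F]_k :=
  \row_i (-1) ^+ b i.

(** Multiplied by its sign, each column lies on the affine line where [w1] equals 1. Independence
    makes these k points distinct, and the line has [#|F|] points. *)
Lemma signs_sub_card (F : finFieldType) (k : nat) (M : 'M[F]_(2, k)) b :
  columns_independent M -> (signs b <= M)%MS -> (k <= #|F|)%N.
Proof.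
case: k M b => // k M b indM /submxP[w1 sE].
have sw i : (w1 *m M) 0 i = (-1) ^+ b i by rewrite -sE mxE.
(* [w2] vanishes on column 0 and [w1] does not, so [w2] is not a multiple of [w1] and serves as a
   coordinate on the line. *)
have [w2 w20 w2M] := exists_annihilator F _ M 0.
rewrite -[leqLHS]card_ord.
apply: (leq_card (fun i => (-1) ^+ b i * (w2 *m M) 0 i)) => i j eqij.
apply/eqP/negPn/negP => ij.
pose c := (-1) ^+ b i * (w2 *m M) 0 i.
have w2E l : c = (-1) ^+ b l * (w2 *m M) 0 l -> ((w2 - c *: w1) *m M) 0 l = 0.
  have lin (A B : 'rV[F]_k.+1) : (A - c *: B) 0 l = A 0 l - c * B 0 l.
    by rewrite !mxE.
  move=> cE; rewrite mulmxBl -scalemxAl lin sw.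
  by rewrite cE mulrAC -expr2 sqrr_sign mul1r subrr.
have /eqP := indM _ _ _ ij (w2E i erefl) (w2E j eqij).
rewrite subr_eq0 => /eqP w2c; move: w2M.
rewrite w2c -scalemxAl mxE sw => /eqP; rewrite mulf_eq0 signr_eq0 orbF => /eqP c0.
by rewrite w2c c0 scale0r eqxx in w20.
Qed.

(** The numbers of signs 1 and -1 agree modulo p, and both are below p, so they are equal. *)
Lemma signs_contains_additive_tuple (p k : nat) (M : 'M['F_p]_(2, k)) b :
  prime p -> (2 < p)%N -> (0 < k)%N -> ~~ odd k -> columns_independent M ->
  (signs b <= M)%MS -> \sum_i (signs b : 'rV['F_p]_k) 0 i = 0 ->
  contains_additive_tuple M.
Proof.
move=> pp p2 k0 evk indM sM sum0.
(* The bound k <= p is strict because k is even and p is odd. *)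
have kp : (k < p)%N.
  rewrite ltn_neqAle -{2}(card_Fp pp) (signs_sub_card _ _ _ _ indM sM) andbT.
  by apply: contraNneq evk => ->; case: (even_prime pp) => // p2'; rewrite p2' in p2.
have N11 : (1 : 'F_p) != -1.
  rewrite -subr_eq0 opprK -(natrD _ 1 1) -(dvdn_pcharf (pchar_Fp pp)).
  by rewrite gtnNdvd.
have cE (c : bool) : [set i | (signs b : 'rV['F_p]_k) 0 i == (-1) ^+ c]
    = [set i | b i == c].
  apply/setP => i; rewrite !inE mxE.
  by case: (b i); case: c; rewrite ?eqxx // ?expr0 ?expr1 1?eq_sym; apply/negbTE; rewrite // eq_sym.
set e := #|[set i | b i == true]|; set d := #|[set i | b i == false]|.
have ed : (d + e = k)%N.
  rewrite -[RHS]card_ord -(cardsC [set i | b i == true]) addnC; congr addn.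
  by apply: eq_card => i; rewrite !inE; case: (b i).
have : d%:R = e%:R :> 'F_p.
  apply/eqP; rewrite -subr_eq0; apply/eqP; rewrite -[RHS]sum0.
  rewrite (bigID (fun i => b i)) /= addrC; congr (_ + _).
    rewrite (eq_bigr (fun=> 1)); last by move=> i /negbTE bi; rewrite mxE bi.
    rewrite sumr_const; congr (_%:R); apply: eq_card => i.
    by rewrite !inE unfold_in; case: (b i).
  rewrite (eq_bigr (fun=> -1)); last by move=> i bi; rewrite mxE bi.
  rewrite sumr_const mulNrn; congr (- _%:R); apply: eq_card => i.
  by rewrite !inE unfold_in; case: (b i).
move=> /(congr1 val) /=; rewrite !val_Fp_nat // !modn_small; last first.
- by apply: leq_ltn_trans kp; rewrite -ed leq_addr.
- by apply: leq_ltn_trans kp; rewrite -ed leq_addl.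
move=> de; exists (signs b); split=> //.
  apply/eqP => /rowP/(_ (Ordinal k0)) /eqP; rewrite !mxE.
  by rewrite signr_eq0.
exists 1, (signs b); rewrite oner_eq0 scale1r; split=> //.
split; first by rewrite (cE false) -/d -ed de mul2n addnn.
by rewrite (cE true) -/e -ed de mul2n addnn.
Qed.

(** * Terms of the expansion that survive the sum over solutions *)

(* [q i = (m, b)] selects, in the i-th factor of the product over i of the sums
   over (m, b) of [chi ((-1) ^+ b * (v_m . x_i + t_m))], the term (m, b); then
   [phase] and [shift] are the parts in x and in t of the resulting exponent. *)
Definition phase {F : pzRingType} {k : nat} (M : 'M[F]_(2, k))
    (q : 'I_k -> 'I_k * bool) (X : 'M[F]_(k, 2)) : F :=
  \sum_i (-1) ^+ (q i).2 * (X *m M) i (q i).1.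

Definition shift {F : pzRingType} {k : nat} (q : 'I_k -> 'I_k * bool)
    (t : 'rV[F]_k) : F :=
  \sum_i (-1) ^+ (q i).2 * t 0 (q i).1.

Lemma phaseD (F : pzRingType) (k : nat) (M : 'M[F]_(2, k)) q :
  {morph phase M q : X Y / X + Y}.
Proof.
move=> X Y; rewrite /phase -big_split; apply: eq_bigr => i _.
by rewrite mulmxDl mxE mulrDr.
Qed.

Lemma shiftD (F : pzRingType) (k : nat) q :
  {morph @shift F k q : s t / s + t}.
Proof.
move=> s t; rewrite /shift -big_split; apply: eq_bigr => i _.
by rewrite mxE mulrDr.
Qed.

Lemma mxtrace_mul_eq0 (F : pzRingType) (m n : nat) (A : 'M[F]_(m, n)) :
  (forall Y : 'M_(n, m), \tr (A *m Y) = 0) -> A = 0.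
Proof.
move=> A0; apply/matrixP => i j; rewrite mxE -[RHS](A0 (delta_mx j i)).
rewrite /mxtrace (bigD1 i) //= big1 ?addr0 => [|l li].
  rewrite mxE (bigD1 j) //= big1 ?addr0 => [|l lj].
    by rewrite mxE !eqxx mulr1.
  by rewrite mxE (negbTE lj) mulr0.
by rewrite mxE big1 // => m' _; rewrite mxE (negbTE li) andbF mulr0.
Qed.

(** The phase is the trace of [M *m Q *m X]. Its vanishing on all solutions [X] puts the rows of
    [M *m Q] in the row space of [M], by duality, so [M *m Q = G *m M]. *)
Lemma phase_eq0 (F : fieldType) (k : nat) (M : 'M[F]_(2, k)) q :
  (forall X : 'M_(k, 2), M *m X = 0 -> phase M q X = 0) ->
  exists G : 'M_2, forall (w : 'rV_2) i,
    (w *m G *m M) 0 i = (-1) ^+ (q i).2 * (w *m M) 0 (q i).1.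
Proof.
move=> ph0; pose Q := \matrix_(m, i) ((-1) ^+ (q i).2 *+ (m == (q i).1)) : 'M[F]_k.
have mulQ n (A : 'M_(n, k)) a i : (A *m Q) a i = (-1) ^+ (q i).2 * A a (q i).1.
  rewrite mxE (bigD1 (q i).1) //= big1 ?addr0 => [|m mq].
    by rewrite mxE eqxx mulr1n mulrC.
  by rewrite mxE (negbTE mq) mulr0.
have /submxP[G GE] : (M *m Q <= M)%MS.
  rewrite submxE; apply/eqP/mxtrace_mul_eq0 => Y.
  rewrite -(mulmxA (M *m Q)) mxtrace_mulC -[RHS](ph0 (cokermx M *m Y)); last first.
    by rewrite mulmxA mulmx_coker mul0mx.
  by rewrite mulmxA; apply: eq_bigr => i _; rewrite mulQ.
by exists G => w i; rewrite -mulmxA -GE mulmxA mulQ.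
Qed.

Lemma phase_or_shift_neq0 (p k : nat) (M : 'M['F_p]_(2, k)) q :
  prime p -> (2 < p)%N -> (1 < k)%N -> ~~ odd k -> columns_independent M ->
  ~ contains_additive_tuple M ->
  (forall X, M *m X = 0 -> phase M q X = 0) ->
  exists t : 'rV['F_p]_k, shift q t != 0.
Proof.
move=> pp p2 k1 evk indM nadd /phase_eq0[G GE].
have [uG|/negbTE nG] := boolP (G \in unitmx).
  (* If [i] and [i'] had the same image, a [w] killing that column would make [w *m G] kill columns
     [i] and [i'], hence vanish. *)
  have jinj : injective (fun i => (q i).1).
    move=> i i' /= jii'; apply/eqP/negPn/negP => ii'.
    have [w w0 wM] := exists_annihilator _ _ M (q i).1.
    have /eqP : w *m G = 0 by apply: indM ii' _ _; rewrite GE -?jii' wM mulr0.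
    by rewrite mulmx_free_eq0 ?row_free_unit // (negbTE w0).
  pose i0 := Ordinal (ltnW k1); exists (delta_mx 0 (q i0).1).
  rewrite /shift (bigD1 i0) //= big1 ?addr0 => [|i ii0].
    by rewrite mxE !eqxx mulr1 signr_eq0.
  by rewrite mxE (inj_eq jinj) (negbTE ii0) mulr0.
(* A nonzero [w] in the left kernel of [G] kills every column [(q i).1]; by independence there is
   only one such column. *)
have [w w0 wG] : exists2 w : 'rV_2, w != 0 & w *m G = 0.
  have: kermx G != 0 by rewrite kermx_eq0 row_free_unit nG.
  by move=> /rowV0Pn[w /sub_kermxP wi w0]; exists w.
have wj i : (w *m M) 0 (q i).1 = 0.
  have := GE w i; rewrite wG mul0mx [LHS]mxE => /esym/eqP.
  by rewrite mulf_eq0 signr_eq0 => /eqP.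
pose i0 := Ordinal (ltnW k1); pose m := (q i0).1.
have jE i : (q i).1 = m.
  apply/eqP/negPn/negP => im; move/eqP: w0; apply.
  by apply: indM im _ _; apply: wj.
have [m' mm'] : exists m', m' != m.
  have: (0 < #|[set~ m]|)%N by rewrite cardsC1 card_ord -subn1 subn_gt0.
  by move=> /card_gt0P[m' ]; rewrite !inE => ?; exists m'.
have [w1 w10 w1m'] := exists_annihilator _ _ M m'.
have w1m : (w1 *m M) 0 m != 0.
  by apply: contraNneq w10 => w1m; apply/eqP/(indM _ _ _ mm').
(* [G] sends every column to plus or minus column [m], where [w1] is nonzero, so [w1 *m G] rescaled
   takes the values of the signs. *)
have sM : (signs (fun i => (q i).2) <= M)%MS.
  apply/submxP; exists (((w1 *m M) 0 m)^-1 *: w1 *m G).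
  by apply/rowP => i; rewrite mxE GE jE -scalemxAl mxE mulVf // mulr1.
(* At this [t] the shift is the sum of the signs. *)
exists (delta_mx 0 m); apply/eqP => sh0; apply: nadd.
apply: (signs_contains_additive_tuple _ _ _ _ pp p2 (ltnW k1) evk indM sM).
rewrite -[RHS]sh0; apply: eq_bigr => i _.
by rewrite jE !mxE !eqxx mulr1.
Qed.

(** * Characters of F_p and orthogonality *)

Record faithful_character (p : nat) (C : numClosedFieldType) (chi : 'F_p -> C) :
    Prop := FaithfulCharacter {
  charD : forall a b, chi (a + b) = chi a * chi b;
  char_eq1 : forall a, chi a = 1 -> a = 0;
  char_norm : forall a, `|chi a| = 1
}.

(** A root of 1 + z + ... + z^(p-1) is a p-th root of unity, different from 1 in characteristic 0,
    hence primitive as p is prime. *)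
Lemma exists_faithful_character (p : nat) (C : numClosedFieldType) :
  prime p -> exists chi : 'F_p -> C, faithful_character p C chi.
Proof.
move=> pp; have p1 := prime_gt1 pp; have p0 := prime_gt0 pp.
pose P : {poly C} := \poly_(i < p) 1.
have /closed_rootP[z] : size P != 1%N.
  rewrite size_poly_eq ?oner_eq0 //; first by rewrite gtn_eqF.
rewrite /root horner_poly => /eqP; under eq_bigr do rewrite mul1r.
move=> sum_z.
have zp : z ^+ p = 1.
  by apply/eqP; rewrite -subr_eq0 subrX1 sum_z mulr0.
have zn1 : z != 1.
  apply/eqP => z1; move/eqP: sum_z; rewrite z1.
  rewrite (eq_bigr (fun=> 1)) => [|i _]; last by rewrite expr1n.
  by rewrite sumr_const card_ord pnatr_eq0 gtn_eqF.
have prim_z : p.-primitive_root z.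
  have [m prim_m] := prim_order_exists p0 zp.
  move/primeP: pp => [_ dvd_p] /dvd_p /orP[] /eqP mE; last by rewrite -mE.
  by case/eqP: zn1; rewrite -[z]expr1 -mE (prim_expr_order prim_m).
have nz : `|z| = 1.
  by apply/eqP; rewrite -(pexpr_eq1 p0) ?normr_ge0 // -normrX zp normr1.
exists (fun a => z ^+ a); split=> [a b|a za1|a].
- have -> : (a + b)%R = ((a + b) %% p)%N :> nat.
    by rewrite -[X in _ = (_ %% X)%N](Fp_cast pp).
  by rewrite (prim_expr_mod prim_z) exprD.
- apply/val_inj => /=; apply/eqP; move/eqP: za1.
  rewrite -(prim_order_dvd prim_z); case: (posnP a) => [->//|a0].
  by rewrite gtnNdvd // -[X in (_ < X)%N](Fp_cast pp).
- by rewrite normrX nz expr1n.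
Qed.

Lemma char0 (p : nat) (C : numClosedFieldType) (chi : 'F_p -> C) :
  faithful_character p C chi -> chi 0 = 1.
Proof.
move=> chiP; have := charD _ _ _ chiP 0 0; rewrite addr0 => /esym/eqP.
rewrite -subr_eq0 -{3}(mulr1 (chi 0)) -mulrBr mulf_eq0 subr_eq0.
by rewrite -normr_eq0 (char_norm _ _ _ chiP) oner_eq0 => /eqP.
Qed.

Lemma sum_character (p : nat) (C : numClosedFieldType) chi (V : finZmodType)
    (A : {set V}) (phi : V -> 'F_p) :
  faithful_character p C chi -> {morph phi : x y / x + y} ->
  {in A &, forall x y, x + y \in A} ->
  \sum_(x in A) chi (phi x)
    = if [forall x in A, phi x == 0] then #|A|%:R else 0.
Proof.
move=> chiP phiD AD; case: ifP => [/forall_inP phi0|/negbT].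
  rewrite -sum1_card natr_sum; apply: eq_bigr => x /phi0 /eqP ->.
  exact: char0 chiP.
rewrite negb_forall => /existsP[y]; rewrite negb_imply => /andP[yA phiy].
pose S := \sum_(x in A) chi (phi x); rewrite -/S.
(* Translation by [y] is injective, so it permutes the finite set [A]; it also multiplies the sum by
   [chi (phi y)], which is not 1. *)
have imA : [set y + x | x in A] = A.
  apply/eqP; rewrite eqEcard card_imset ?leqnn ?andbT; last exact: addrI.
  by apply/subsetP => _ /imsetP[x xA ->]; apply: AD.
have SE : S = chi (phi y) * S.
  rewrite {1}/S -{1}imA big_imset /=; last by move=> ? ? _ _; apply: addrI.
  by rewrite mulr_sumr; apply: eq_bigr => x _; rewrite phiD (charD _ _ _ chiP).
move/eqP: SE; rewrite -{1}(mul1r S) -subr_eq0 -mulrBl mulf_eq0 => /orP[|/eqP//].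
rewrite subr_eq0 eq_sym => /eqP/(char_eq1 _ _ _ chiP) y0.
by rewrite y0 eqxx in phiy.
Qed.

(** * The functions f_t and their expansion in characters *)

(** This is f_t, the cosine being the real part of a faithful character. *)
Definition wave {R : realType} {p k : nat} (chi : 'F_p -> R[i])
    (M : 'M['F_p]_(2, k)) (t : 'rV_k) (x : 'rV_2) : R :=
  (\sum_m complex.Re (chi ((x *m M + t) 0 m))) / k%:R.

(** As [chi a] has modulus 1, its conjugate is its inverse [chi (- a)]. *)
Lemma Re_character (R : realType) (p : nat) (chi : 'F_p -> R[i]) a :
  faithful_character p R[i] chi ->
  ((complex.Re (chi a))%:C)%C *+ 2 = \sum_(b : bool) chi ((-1) ^+ b * a).
Proof.
move=> chiP; rewrite big_bool expr0 expr1 mul1r mulN1r.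
rewrite complexRe ReE -[LHS]mulr_natr divfK ?pnatr_eq0 // [RHS]addrC; congr (_ + _).
have n1 := char_norm _ _ _ chiP a.
have n0 : chi a != 0 by rewrite -normr_eq0 n1 oner_eq0.
apply: (mulfI n0); rewrite -(charD _ _ _ chiP) subrr (char0 _ _ _ chiP).
by rewrite -normCK n1 expr1n.
Qed.

Lemma wave_bounded (R : realType) (p k : nat) (chi : 'F_p -> R[i]) M t x :
  faithful_character p R[i] chi -> (0 < k)%N -> `|@wave R p k chi M t x| <= 1.
Proof.
move=> chiP k0; rewrite /wave normrM normfV normr_nat ler_pdivrMr ?ltr0n // mul1r.
apply: le_trans (ler_norm_sum _ _ _) _.
rewrite -[leRHS]mulr1 -[k in k%:R * _]card_ord mulr_natl -sumr_const ler_sum // => m _.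
by rewrite -lecR (le_trans (normc_ge_Re _)) // (char_norm _ _ _ chiP).
Qed.

(** The factor 2k clears the average over m and the 1/2 of each cosine, leaving all coefficients
    1. *)
Lemma wave_expand (R : realType) (p k : nat) (chi : 'F_p -> R[i]) M t x :
  faithful_character p R[i] chi -> (0 < k)%N ->
  (2 * k)%:R * ((@wave R p k chi M t x)%:C)%C
    = \sum_(q : 'I_k * bool) chi ((-1) ^+ q.2 * (x *m M + t) 0 q.1).
Proof.
move=> chiP k0; rewrite /wave rmorphM fmorphV rmorph_nat rmorph_sum natrM /=.
rewrite -mulrA [k%:R * _]mulrC divfK ?pnatr_eq0 -?lt0n // mulr_sumr.
rewrite -(pair_bigA _ (fun m (b : bool) => chi ((-1) ^+ b * (x *m M + t) 0 m))).
by apply: eq_bigr => m _; rewrite mulr_natl (Re_character _ _ _ _ chiP).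
Qed.

(** Each character in the expansion is nontrivial in x, since independence from another column keeps
    a column from being zero. *)
Lemma wave_mean (R : realType) (p k : nat) (chi : 'F_p -> R[i]) M t :
  faithful_character p R[i] chi -> (1 < k)%N -> columns_independent M ->
  average [set: 'rV['F_p]_2] (@wave R p k chi M t) = 0.
Proof.
move=> chiP k1 indM; rewrite /average; apply/eqP; rewrite mulf_eq0; apply/orP; left.
apply/eqP/complexI/(@mulfI _ (2 * k)%:R).
  by rewrite pnatr_eq0 muln_eq0 /= -lt0n ltnW.
rewrite rmorph0 mulr0 rmorph_sum mulr_sumr /=.
under eq_bigr do rewrite (wave_expand _ _ _ _ _ _ _ chiP (ltnW k1)).
rewrite exchange_big big1 //= => -[m b] _ /=.
under eq_bigr do rewrite mxE mulrDr (charD _ _ _ chiP).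
rewrite -mulr_suml (sum_character _ _ _ _ _ (fun x => (-1) ^+ b * (x *m M) 0 m) chiP).
- case: ifP => [/forall_inP all0|]; last by rewrite mul0r.
  have [m' mm'] : exists m', m' != m.
    have: (0 < #|[set~ m]|)%N by rewrite cardsC1 card_ord -subn1 subn_gt0.
    by move=> /card_gt0P[m' ]; rewrite !inE => ?; exists m'.
  have [w w0 wm'] := exists_annihilator _ _ M m'.
  have := all0 w (in_setT _); rewrite mulf_eq0 signr_eq0 => /eqP wm.
  by rewrite (indM _ _ _ mm' wm' wm) eqxx in w0.
- by move=> x y; rewrite mulmxDl mxE mulrDr.
- by move=> x y _ _; rewrite inE.
Qed.

(** Distributing the product over [i] gives one term per [q], and multiplicativity of [chi]
    separates [t] from [X]. *)
Lemma sum_sol_expand (R : realType) (p k : nat) (chi : 'F_p -> R[i]) M t :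
  faithful_character p R[i] chi -> (0 < k)%N ->
  (2 * k)%:R ^+ k
    * ((\sum_(X in sol 2 M) \prod_(i < k) @wave R p k chi M t (row i X))%:C)%C
  = \sum_(q : {ffun 'I_k -> 'I_k * bool})
      chi (shift q t) * \sum_(X in sol 2 M) chi (phase M q X).
Proof.
move=> chiP k0; rewrite rmorph_sum mulr_sumr /=.
under [RHS]eq_bigr do rewrite mulr_sumr.
rewrite [RHS]exchange_big; apply: eq_bigr => X _ /=.
rewrite rmorph_prod /= -[k in _ ^+ k]card_ord -prodr_const -big_split /=.
under eq_bigr do rewrite (wave_expand _ _ _ _ _ _ _ chiP k0).
rewrite bigA_distr_bigA; apply: eq_bigr => q _ /=.
rewrite -(charD _ _ _ chiP) /shift /phase -big_split /=.
rewrite (big_morph chi (charD _ _ _ chiP) (char0 _ _ _ chiP)).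
apply: eq_bigr => i _; rewrite -mulrDr addrC; congr (chi (_ * _)).
by rewrite -row_mul mxE [row _ _ _ _]mxE.
Qed.

Lemma sum_phase (R : realType) (p k : nat) (chi : 'F_p -> R[i]) M q :
  faithful_character p R[i] chi ->
  \sum_(X in sol 2 M) chi (@phase 'F_p k M q X)
    = if [forall X in sol 2 M, phase M q X == 0] then #|sol 2 M|%:R else 0.
Proof.
move=> chiP; apply: sum_character chiP (phaseD _ _ M q) _ => X Y.
by rewrite !inE mulmxDr => /eqP -> /eqP ->; rewrite addr0.
Qed.

Lemma T_system_wave0_gt0 (R : realType) (p k : nat) (chi : 'F_p -> R[i]) M :
  faithful_character p R[i] chi -> (0 < k)%N ->
  0 < T_system M (@wave R p k chi M 0).
Proof.
move=> chiP k0; have sol0 : 0 \in sol 2 M by rewrite inE mulmx0.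
have sol_gt0 : (0 < #|sol 2 M|)%N by apply/card_gt0P; exists 0.
rewrite /T_system /average divr_gt0 ?ltr0n // -ltcR.
have c0 : 0 < (2 * k)%:R ^+ k :> R[i] by rewrite exprn_gt0 // ltr0n muln_gt0.
rewrite -(pmulr_rgt0 _ c0) sum_sol_expand //.
have term_ge0 q : 0 <= chi (shift q 0) * \sum_(X in sol 2 M) chi (phase M q X).
  rewrite /shift big1 ?(char0 _ _ _ chiP) ?mul1r => [|i _]; last by rewrite mxE mulr0.
  by rewrite sum_phase //; case: ifP.
(* This is the term G = 1: its phase is the trace of [X *m M], equal to that of [M *m X], which is 0
   on solutions. *)
rewrite (bigD1 [ffun i => (i, false)]) //= ltr_pwDl //; last exact: sumr_ge0.
rewrite /shift big1 ?(char0 _ _ _ chiP) ?mul1r => [|i _]; last by rewrite mxE mulr0.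
rewrite sum_phase //; case: ifP => [_|/negbT]; first by rewrite ltr0n.
rewrite negb_forall => /existsP[X]; rewrite negb_imply inE => /andP[/eqP MX].
rewrite /phase; under eq_bigr do rewrite ffunE /= expr0 mul1r.
by rewrite -/(\tr (X *m M)) mxtrace_mulC MX raddf0 eqxx.
Qed.

Theorem theorem3p1 (R : realType) (p k : nat) (M : 'M['F_p]_(2, k))
    (hp : prime p) (hp2 : (2 < p)%N) (hk : (2 < k)%N)
    (hM : \rank M = 2%N)
    (hs : min_length M = (k - 1)%N)
    (hadd : ~ contains_additive_tuple M) :
  exists f : 'rV['F_p]_2 -> R,
    [/\ forall x, -1 <= f x <= 1,
        average [set: 'rV['F_p]_2] f = 0
      & T_system M f < 0].
Proof.
have k1 := ltnW hk; have k0 := ltnW k1.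
have indM := columns_independent_min_length _ _ M hM hs k1.
have [chi chiP] := exists_faithful_character p R[i] hp.
have Tpos := T_system_wave0_gt0 _ _ _ _ M chiP k0.
have [oddk|evk] := boolP (odd k).
  exists (fun x => - wave chi M 0 x); split.
  - by move=> x; rewrite -ler_norml normrN wave_bounded.
  - have := wave_mean _ _ _ _ M 0 chiP k1 indM.
    by rewrite /average sumrN mulNr => ->; rewrite oppr0.
  - rewrite /T_system /average.
    under eq_bigr do rewrite prodrN card_ord -signr_odd oddk expr1 mulN1r.
    by rewrite sumrN mulNr oppr_lt0.
have sum0 : \sum_(t : 'rV['F_p]_k) T_system M (wave chi M t) = 0.
  rewrite /T_system /average -mulr_suml; apply/eqP.
  rewrite mulf_eq0; apply/orP; left; apply/eqP/complexI.
  apply/(@mulfI _ ((2 * k)%:R ^+ k)).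
    by rewrite expf_neq0 // pnatr_eq0 muln_eq0 /= -lt0n.
  rewrite rmorph0 mulr0 rmorph_sum mulr_sumr /=.
  under eq_bigr do rewrite sum_sol_expand //.
  rewrite exchange_big big1 //= => q _; rewrite -mulr_suml sum_phase //.
  case: ifP => [/forall_inP ph0|_]; last by rewrite mulr0.
  have [t shn0] : exists t : 'rV['F_p]_k, shift q t != 0.
    apply: (phase_or_shift_neq0 _ _ M) => // X MX.
    by apply/eqP/ph0; rewrite inE; apply/eqP.
  rewrite (eq_bigl (mem [set: 'rV['F_p]_k])); last first.
    by move=> x; rewrite [RHS]in_setT.
  rewrite (sum_character _ _ _ _ _ _ chiP (shiftD _ _ q)); last by move=> *; rewrite inE.
  case: ifP => [/forall_inP sh0|]; last by rewrite mul0r.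
  by rewrite sh0 ?inE in shn0.
(* Nonnegative values with sum 0 would all be 0, contradicting positivity at t = 0. *)
have [t tneg] : exists t : 'rV['F_p]_k, T_system M (@wave R p k chi M t) < 0.
  apply/existsP; apply: contraTT Tpos => /existsPn Tge0.
  have T0 t : true -> 0 <= T_system M (@wave R p k chi M t) by rewrite leNgt Tge0.
  by rewrite (psumr_eq0P T0 sum0) ?ltxx.
exists (wave chi M t); split=> // [x|]; first by rewrite -ler_norml wave_bounded.
exact: (wave_mean _ _ _ _ _ _ chiP).
Qed.
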